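(* The symmetric functions (formal power series of symmetric functions) $$\frac{\sum_{n\geq 0} (-1)^n e_{2n+1}}{\sum_{n\geq 0} (-1)^n e_{2n}}\qquad\text{and}\qquad \sum_{n\geq 0} (-1)^n Lie_{2n+1}$$ are plethystic inverses of each other.
   Context: We work in the completion (by degree) of the ring of symmetric functions in variables $x_1,x_2,\dots$ over a field of characteristic zero (e.g. $\mathbb{Q}$). $e_n$ is the elementary symmetric function ($e_0=1$) and $p_n$ the power sum. $Lie_n$ is the Frobenius characteristic of the $S_n$-representation on the multilinear component of the free Lie algebra on $n$ generators; explicitly, $Lie_n=\frac1n\sum_{d\mid n}\mu(d)\,p_d^{n/d}$ for $n\ge 1$, where $\mu$ is the number-theoretic Möbius function. Plethysm $f[g]$ (where $g$ has zero constant term, so that it is well defined for series): for fixed $g$, $f\mapsto f[g]$ is the continuous algebra homomorphism fixing constants with $p_n\mapsto p_n[g]$, where $p_n[\cdot]$ is the continuous algebra homomorphism fixing constants with $p_n[p_m]=p_{nm}$. Two series $f,g$ with zero constant term are plethystic inverses if $f[g]=p_1=g[f]$. The quotient is taken in the ring of formal series (the denominator has constant term 1). *)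

(* Defs.v *)
From HB Require Import structures.
From mathcomp Require Import all_boot all_order all_algebra.
From mathcomp Require Import perm boolp.
From mathcomp Require Import mpoly zify.

Set Implicit Arguments.
Unset Strict Implicit.
Unset Printing Implicit Defensive.

Import GRing.Theory.
Local Open Scope ring_scope.

(* The substitution x_n := 0 from n.+1 to n variables. *)
Definition drop_last (F : fieldType) (n : nat) : n.+1.-tuple {mpoly F[n]} :=
  [tuple (if unlift ord_max i is Some j then 'X_j else 0) | i < n.+1].

(* The completion of the ring of symmetric functions is the product over d of
   the inverse limits (over the number n of variables) of the spaces of
   homogeneous symmetric polynomials of degree d in n variables.  [f d n] is
   the degree d part of f restricted to the variables x_0, ..., x_(n-1). *)
Record symseries (F : fieldType) := SymSeries {
  scomp :> forall d n : nat, {mpoly F[n]};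
  scomp_homog : forall d n, scomp d n \is d.-homog;
  scomp_sym : forall d n, scomp d n \is symmetric;
  scomp_stable : forall d n, scomp d n.+1 \mPo drop_last F n = scomp d n }.

Lemma symseriesP (F : fieldType) (f g : symseries F) :
  (forall d n, f d n = g d n) -> f = g.
Proof.
case: f g => [f f1 f2 f3] [g g1 g2 g3] /= fg.
have e : f = g by apply: functional_extensionality_dep => d;
  apply: functional_extensionality_dep => n; exact: fg.
by case: _ / e in g1 g2 g3 *; congr SymSeries; apply: Prop_irrelevance.
Qed.

HB.instance Definition _ (F : fieldType) := gen_eqMixin (symseries F).
HB.instance Definition _ (F : fieldType) := gen_choiceMixin (symseries F).

Section Ring.
Variable F : fieldType.
Implicit Types f g h : symseries F.

Program Definition szero : symseries F := @SymSeries F (fun d n => 0) _ _ _.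
Next Obligation. exact: rpred0. Qed.
Next Obligation. exact: rpred0. Qed.
Next Obligation. by rewrite raddf0. Qed.

Program Definition sopp f : symseries F :=
  @SymSeries F (fun d n => - f d n) _ _ _.
Next Obligation. by rewrite rpredN scomp_homog. Qed.
Next Obligation. by rewrite rpredN scomp_sym. Qed.
Next Obligation. by rewrite raddfN /= scomp_stable. Qed.

Program Definition sadd f g : symseries F :=
  @SymSeries F (fun d n => f d n + g d n) _ _ _.
Next Obligation. by rewrite rpredD ?scomp_homog. Qed.
Next Obligation. by rewrite rpredD ?scomp_sym. Qed.
Next Obligation. by rewrite raddfD /= !scomp_stable. Qed.

Program Definition sscale (c : F) f : symseries F :=
  @SymSeries F (fun d n => c *: f d n) _ _ _.
Next Obligation. by rewrite rpredZ ?scomp_homog. Qed.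
Next Obligation. by rewrite rpredZ ?scomp_sym. Qed.
Next Obligation. by rewrite comp_mpolyZ scomp_stable. Qed.

Program Definition sone : symseries F :=
  @SymSeries F (fun d n => (d == 0)%:R) _ _ _.
Next Obligation. by case: d => [|d]; [exact: dhomog1 | exact: rpred0]. Qed.
Next Obligation. by case: d => [|d]; [exact: rpred1 | exact: rpred0]. Qed.
Next Obligation. by rewrite raddfMn /= comp_mpoly1. Qed.

Program Definition smul f g : symseries F :=
  @SymSeries F (fun d n => \sum_(i < d.+1) f i n * g (d - i)%N n) _ _ _.
Next Obligation.
apply: rpred_sum => i _.
have id : (i <= d)%N by rewrite -ltnS.
by have := dhomogM (scomp_homog f i n) (scomp_homog g (d - i) n);
  rewrite subnKC.
Qed.
Next Obligation. by apply: rpred_sum => i _; rewrite rpredM ?scomp_sym. Qed.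
Next Obligation.
rewrite raddf_sum; apply: eq_bigr => i _ /=.
by rewrite rmorphM /= !scomp_stable.
Qed.

Fact saddA : associative sadd.
Proof. by move=> f g h; apply: symseriesP => d n /=; rewrite addrA. Qed.
Fact saddC : commutative sadd.
Proof. by move=> f g; apply: symseriesP => d n /=; rewrite addrC. Qed.
Fact sadd0 : left_id szero sadd.
Proof. by move=> f; apply: symseriesP => d n /=; rewrite add0r. Qed.
Fact saddN : left_inverse szero sopp sadd.
Proof. by move=> f; apply: symseriesP => d n /=; rewrite addNr. Qed.

HB.instance Definition _ :=
  GRing.isZmodule.Build (symseries F) saddA saddC sadd0 saddN.

Definition spoly f (D n : nat) : {poly {mpoly F[n]}} :=
  \poly_(d < D.+1) f d n.

Lemma coef_spolyM (D n d : nat) f (p q : {poly {mpoly F[n]}}) g :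
  (d <= D)%N ->
  (forall i, (i <= D)%N -> p`_i = f i n) ->
  (forall i, (i <= D)%N -> q`_i = g i n) ->
  (p * q)`_d = smul f g d n.
Proof.
move=> dD pf qg; rewrite coefM /=; apply: eq_bigr => i _.
have iD : (i <= D)%N by apply: leq_trans dD; rewrite -ltnS.
by rewrite pf // qg // (leq_trans (leq_subr _ _)).
Qed.

Lemma coef_spoly (D n i : nat) f : (i <= D)%N -> (spoly f D n)`_i = f i n.
Proof. by move=> iD; rewrite coef_poly ltnS iD. Qed.

Fact smulA : associative smul.
Proof.
move=> f g h; apply: symseriesP => d n.
have P k := @coef_spoly d n ^~ k.
have M k l i (id : (i <= d)%N) :=
  coef_spolyM id (fun j => P k j) (fun j => P l j).
rewrite -(@coef_spolyM d n d f (spoly f d n) (spoly g d n * spoly h d n)) //.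
- rewrite -(@coef_spolyM d n d _ (spoly f d n * spoly g d n) (spoly h d n)) //.
  + by rewrite mulrA.
  + exact: M.
  + by move=> i; exact: P.
- by move=> i; exact: P.
- exact: M.
Qed.

Fact smulC : commutative smul.
Proof.
move=> f g; apply: symseriesP => d n.
have P k := @coef_spoly d n ^~ k.
rewrite -(coef_spolyM (leqnn d) (fun j => P f j) (fun j => P g j)) mulrC.
exact: (coef_spolyM (leqnn d) (fun j => P g j) (fun j => P f j)).
Qed.

Fact smul1 : left_id sone smul.
Proof.
move=> f; apply: symseriesP => d n /=.
rewrite big_ord_recl /= mul1r subn0 big1 ?addr0 // => i _.
by rewrite /= mul0r.
Qed.

Fact smulDl : left_distributive smul sadd.
Proof.
move=> f g h; apply: symseriesP => d n /=.
by rewrite -big_split /=; apply: eq_bigr => i _; rewrite mulrDl.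
Qed.

Fact sone_neq0 : sone != 0.
Proof.
apply/eqP => /(congr1 (fun f : symseries F => f 0%N 0%N)) /= /eqP.
by rewrite oner_eq0.
Qed.

HB.instance Definition _ := GRing.Zmodule_isComNzRing.Build (symseries F)
  smulA smulC smul1 smulDl sone_neq0.

Fact sscaleA (a b : F) f : sscale a (sscale b f) = sscale (a * b) f.
Proof. by apply: symseriesP => d n /=; rewrite scalerA. Qed.
Fact sscale1 : left_id 1 sscale.
Proof. by move=> f; apply: symseriesP => d n /=; rewrite scale1r. Qed.
Fact sscaleDr : right_distributive sscale +%R.
Proof. by move=> a f g; apply: symseriesP => d n /=; rewrite scalerDr. Qed.
Fact sscaleDl f : {morph sscale^~ f : a b / a + b}.
Proof. by move=> a b; apply: symseriesP => d n /=; rewrite scalerDl. Qed.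

HB.instance Definition _ := GRing.Zmodule_isLmodule.Build F (symseries F)
  sscaleA sscale1 sscaleDr sscaleDl.

Fact sscaleAl (a : F) f g : a *: (f * g) = (a *: f) * g.
Proof.
apply: symseriesP => d n /=; rewrite scaler_sumr.
by apply: eq_bigr => i _; rewrite scalerAl.
Qed.

HB.instance Definition _ :=
  GRing.Lmodule_isLalgebra.Build F (symseries F) sscaleAl.
HB.instance Definition _ :=
  GRing.Lalgebra_isComAlgebra.Build F (symseries F).

Definition sunit : pred (symseries F) := fun f => `[< exists g, g * f = 1 >].

Definition sinv f : symseries F :=
  if pselect (exists g, g * f = 1) is left e then sval (cid e) else f.

Fact smulVf : {in sunit, left_inverse 1 sinv *%R}.
Proof.
move=> f /asboolP fu; rewrite /sinv; case: pselect => // e.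
by case: (cid e).
Qed.

Fact sunitP f g : g * f = 1 -> sunit f.
Proof. by move=> gf; apply/asboolP; exists g. Qed.

Fact sinv_out : {in [predC sunit], sinv =1 id}.
Proof.
move=> f; rewrite inE => /negP fu; rewrite /sinv; case: pselect => // e.
by case: fu; apply/asboolP.
Qed.

HB.instance Definition _ := GRing.ComNzRing_hasMulInverse.Build (symseries F)
  smulVf sunitP sinv_out.

Lemma scompD f g d n : (f + g) d n = f d n + g d n. Proof. by []. Qed.

Lemma scompM f g d n : (f * g) d n = \sum_(i < d.+1) f i n * g (d - i)%N n.
Proof. by []. Qed.

Lemma scomp_sum (u : nat -> symseries F) (N d n : nat) :
  (\sum_(k < N) u k) d n = \sum_(k < N) u k d n.
Proof.
elim: N => [|N IH]; first by rewrite !big_ord0.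
by rewrite !big_ord_recr scompD IH.
Qed.

Definition const_term f : F := (f 0%N 0%N)@_0%MM.

Lemma const_termE f n : f 0%N n = (const_term f)%:MP.
Proof.
have cst m (p : {mpoly F[m]}) : p \is 0.-homog -> p = (p@_0%MM)%:MP.
  move=> /dhomogP hp; apply/mpolyP => k; rewrite mcoeffC.
  case: eqVneq => [->|k0]; rewrite ?mulr1 ?mulr0 //.
  apply: memN_msupp_eq0; apply: contra_neqN k0 => /hp /= /eqP.
  by rewrite mdeg_eq0 => /eqP ->.
elim: n => [|n IH]; first exact/cst/scomp_homog.
rewrite (cst _ _ (scomp_homog f 0 n.+1)); congr (_%:MP).
have := scomp_stable f 0 n; rewrite IH (cst _ _ (scomp_homog f 0 n.+1)).
by rewrite comp_mpolyC => /(congr1 (mcoeff 0%MM));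
  rewrite !mcoeffC !eqxx !mulr1.
Qed.

(* The topology of the completion: f and g are N-close when they agree in all
   degrees less than N. *)
Definition agree (N : nat) f g := forall d n, (d < N)%N -> f d n = g d n.

Definition scontinuous (phi : symseries F -> symseries F) :=
  forall f N, exists M, forall g, agree M f g -> agree N (phi f) (phi g).

(* The infinite sum of a family u such that u k has no terms of degree less
   than k (see fsum_cvg): only the first d.+1 terms contribute to degree d. *)
Program Definition fsum (u : nat -> symseries F) : symseries F :=
  @SymSeries F (fun d n => (\sum_(k < d.+1) u k) d n) _ _ _.
Next Obligation. exact: scomp_homog. Qed.
Next Obligation. exact: scomp_sym. Qed.
Next Obligation. exact: scomp_stable. Qed.

Lemma fsum_cvg (u : nat -> symseries F) :
  (forall k, agree k (u k) 0) ->
  forall N M, (N <= M)%N -> agree N (\sum_(k < M) u k) (fsum u).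
Proof.
move=> u0 N M NM d n dN /=; rewrite !scomp_sum.
rewrite -(subnKC (leq_trans dN NM)) big_split_ord /= [X in _ + X]big1 ?addr0 //.
by move=> k _; rewrite u0 // ltn_addr.
Qed.

Lemma const_term1_unit f : const_term f = 1 -> f \is a GRing.unit.
Proof.
move=> f1; pose u k : symseries F := (1 - f) ^+ k.
have u0 k : agree k (u k) 0.
  elim: k => [|k IH] d n //; rewrite /u exprS scompM => dk.
  rewrite big1 // => -[[|i] /= id] _.
    rewrite const_termE f1 mpolyC1; have -> : (1 : {mpoly F[n]}) - 1 = 0
      by rewrite subrr.
    by rewrite mul0r.
  rewrite -/(u k) IH ?mulr0 //; lia.
apply/asboolP; exists (fsum u); apply: symseriesP => d n.
transitivity (((\sum_(k < d.+1) u k) * f) d n).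
  rewrite !scompM; apply: eq_bigr => i _; congr (_ * _).
  by rewrite -(fsum_cvg u0 (leqnn d.+1)).
have -> : (\sum_(k < d.+1) u k) * f = 1 - u d.+1.
  have ef : f = 1 - (1 - f) by rewrite opprB addrC subrK.
  rewrite [X in _ * X]ef mulrC /u -[X in _ = X - _](expr1n _ d.+1) subrXX.
  by congr (_ * _); apply: eq_bigr => i _; rewrite expr1n mul1r.
by rewrite scompD (_ : (- u d.+1) d n = 0) ?addr0 //= u0 ?oppr0.
Qed.

End Ring.

Section SymmetricFunctions.
Variable F : fieldType.

Lemma drop_last_lift n (j : 'I_n) : (drop_last F n)`_(lift ord_max j) = 'X_j.
Proof. by rewrite -tnth_nth tnth_mktuple liftK. Qed.

Lemma drop_last_max n : (drop_last F n)`_n = 0.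
Proof.
rewrite -[n in LHS]/(nat_of_ord (@ord_max n)) -tnth_nth tnth_mktuple.
by rewrite unlift_none.
Qed.

Lemma widen_lift n (j : 'I_n) : widen_ord (leqnSn n) j = lift ord_max j.
Proof. by apply: val_inj; rewrite /= /bump leqNgt ltn_ord. Qed.

Lemma mwiden_drop_last n (p : {mpoly F[n]}) : mwiden p \mPo drop_last F n = p.
Proof.
have -> : mwiden p = \sum_(m <- msupp p) mwiden (p@_m *: 'X_[m]).
  by rewrite {1}(mpolyE p) [LHS](raddf_sum (@mwiden n F)).
rewrite [RHS]mpolyE [LHS]raddf_sum /=; apply: eq_bigr => m _.
rewrite mwidenZ comp_mpolyZ mwidenX comp_mpolyX big_ord_recr /=.
rewrite mnmwiden_ordmax expr0 mulr1; congr (_ *: _).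
rewrite [RHS]mpolyXE_id; apply: eq_bigr => i _.
by rewrite mnmwiden_widen (tnth_nth 0) widen_lift drop_last_lift.
Qed.

Program Definition elemsym (k : nat) : symseries F :=
  @SymSeries F (fun d n => if d == k then mesym n F k else 0) _ _ _.
Next Obligation.
case: eqP => [->|_]; last exact: rpred0.
apply/dhomogP => m; rewrite mem_msupp_mesym => /andP[/eqP mk _].
exact: mk.
Qed.
Next Obligation. by case: eqP => _; [exact: mesym_sym | exact: rpred0]. Qed.
Next Obligation.
case: eqP => _; last by rewrite raddf0.
case: k => [|k]; first by rewrite !mesym0E comp_mpoly1.
rewrite mesymSS raddfD /= rmorphM /= comp_mpolyXU drop_last_max mulr0 addr0.
exact: mwiden_drop_last.
Qed.

(* For k = 0 the sums are not compatible with x_n := 0, so p_0 is set to 0. *)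
Program Definition powersum (k : nat) : symseries F :=
  @SymSeries F (fun d n =>
    if (d == k) && (0 < k)%N then \sum_(i < n) 'X_i ^+ k else 0) _ _ _.
Next Obligation.
case: ifP => [/andP[/eqP -> _]|_]; last exact: rpred0.
apply: rpred_sum => i _.
have := @dhomogMn _ _ mdeg 1 ('X_i : {mpoly F[n]}) k; rewrite mul1n; apply.
by rewrite dhomogX /= mdeg1.
Qed.
Next Obligation.
case: ifP => _; last exact: rpred0.
apply/issymP => s; rewrite raddf_sum /= [RHS](reindex_inj (@perm_inj _ s)) /=.
apply: eq_bigr => i _; rewrite rmorphXn /= msymX; congr (_ ^+ _); congr 'X_[_].
by apply/mnmP => j; rewrite mnmE !mnm1E (can2_eq (permK s) (permKV s)).
Qed.
Next Obligation.
case: ifP => [/andP[_ k0]|_]; last by rewrite raddf0.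
rewrite raddf_sum /= big_ord_recr /= rmorphXn /= comp_mpolyXU drop_last_max.
rewrite expr0n eqn0Ngt k0 addr0; apply: eq_bigr => i _.
by rewrite rmorphXn /= comp_mpolyXU widen_lift drop_last_lift.
Qed.

Definition moebius (d : nat) : int :=
  if all (fun p => logn p d == 1%N) (primes d)
  then (-1) ^+ size (primes d) else 0.

(* The Frobenius characteristic of the multilinear component of the free Lie
   algebra on n generators, given by its explicit formula (n > 0). *)
Definition Lie (n : nat) : symseries F :=
  n%:R^-1 *:
    \sum_(d <- divisors n) (moebius d)%:~R *: powersum d ^+ (n %/ d)%N.

Definition psum_hom_spec (G : nat -> symseries F)
    (phi : {lrmorphism symseries F -> symseries F}) :=
  scontinuous phi /\ forall m, (0 < m)%N -> phi (powersum m) = G m.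

(* The continuous F-algebra endomorphism mapping p_m to G m for all m > 0.  In
   characteristic 0 it is unique, and it exists as soon as the lowest degree
   occurring in G m tends to infinity; otherwise the identity is returned. *)
Definition psum_hom (G : nat -> symseries F) :
    {lrmorphism symseries F -> symseries F} :=
  if pselect (exists phi, psum_hom_spec G phi) is left e
  then sval (cid e) else idfun.

(* p_n[g] *)
Definition psum_pleth (n : nat) (g : symseries F) : symseries F :=
  psum_hom (fun m => powersum (n * m)) g.

(* f[g], for g with zero constant term *)
Definition pleth (f g : symseries F) : symseries F :=
  psum_hom (fun n => psum_pleth n g) f.

Definition plethystic_inverses (f g : symseries F) :=
  [/\ const_term f = 0, const_term g = 0,
      pleth f g = powersum 1 & pleth g f = powersum 1].

End SymmetricFunctions.

(* Main.v *)
(* Let chi be the odd function with chi(2n+1) = (-1)^n and chi(2n) = 0, which is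
   completely multiplicative, and put atan x = sum_n chi(n) x^n / n.  Newton's
   identities show that the quotient T of the alternating sums of the odd and
   even e_n satisfies D T = (1 + T^2) sum_k chi(k) p_k for the Euler derivation
   D, whence atan T = A, where A = sum_k chi(k) p_k / k.  Summing over n = d m,
   the Lie series is L = sum_d mu(d) chi(d) / d atan(p_d).  As
   sum_(d | n) mu(d) = 0 for n > 1 and chi is multiplicative, A[L] = atan(p_1)
   and L[T] = sum_d mu(d) chi(d) / d p_d[A] = p_1; the former yields T[L] = p_1
   because atan is injective.  The homomorphisms p_m |-> G_m that define
   plethysm exist because, by the fundamental theorem on symmetric polynomials,
   the images of the e_k may be prescribed freely, and Newton's identities turn
   prescribed images of the p_m into images of the e_k. *)
Require Import Defs.
From mathcomp Require Import all_boot all_order all_algebra.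
From HB Require Import structures.
From mathcomp Require Import boolp mpoly zify ring.

Set Implicit Arguments.
Unset Strict Implicit.
Unset Printing Implicit Defensive.

Import GRing.Theory.
Local Open Scope ring_scope.

(** * Orders of vanishing, written [agree a f 0], and infinite sums *)

Section Agree.
Variable F : fieldType.
Implicit Types (f g h : symseries F) (N M a b : nat).

Lemma scomp0 d n : (0 : symseries F) d n = 0. Proof. by []. Qed.
Lemma scompB f g d n : (f - g) d n = f d n - g d n. Proof. by []. Qed.
Lemma scompZ (c : F) f d n : (c *: f) d n = c *: f d n. Proof. by []. Qed.
Lemma scomp1 d n : (1 : symseries F) d n = (d == 0%N)%:R. Proof. by []. Qed.

Lemma agree_refl N f : agree N f f. Proof. by []. Qed.

Lemma agree_sym N f g : agree N f g -> agree N g f.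
Proof. by move=> fg d n dN; rewrite fg. Qed.

Lemma agree_trans N g f h : agree N f g -> agree N g h -> agree N f h.
Proof. by move=> fg gh d n dN; rewrite fg // gh. Qed.

Lemma agree_le N M f g : (N <= M)%N -> agree M f g -> agree N f g.
Proof. by move=> NM fg d n dN; rewrite fg // (leq_trans dN). Qed.

Lemma agree_eq f g : (forall N, agree N f g) -> f = g.
Proof. by move=> fg; apply: symseriesP => d n; apply: (fg d.+1). Qed.

Lemma agreeD N f g f' g' :
  agree N f f' -> agree N g g' -> agree N (f + g) (f' + g').
Proof. by move=> ff gg d n dN; rewrite !scompD ff ?gg. Qed.

Lemma agreeZ N (c : F) f g : agree N f g -> agree N (c *: f) (c *: g).
Proof. by move=> fg d n dN; rewrite !scompZ fg. Qed.

Lemma agree_subr0 N f g : agree N (f - g) 0 <-> agree N f g.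
Proof.
split=> fg d n dN; last by rewrite scompB fg // subrr.
by have /eqP := fg d n dN; rewrite scompB scomp0 subr_eq0 => /eqP.
Qed.

Lemma agreeM N f g f' g' :
  agree N f f' -> agree N g g' -> agree N (f * g) (f' * g').
Proof.
move=> ff gg d n dN; rewrite !scompM; apply: eq_bigr => i _.
have id := ltn_ord i; rewrite ff ?gg //; lia.
Qed.

Lemma agree_sum (I : Type) (r : seq I) (P : pred I) N
    (u v : I -> symseries F) :
  (forall i, P i -> agree N (u i) (v i)) ->
  agree N (\sum_(i <- r | P i) u i) (\sum_(i <- r | P i) v i).
Proof.
move=> uv; elim/big_rec2: _ => // i x y Pi xy; exact: agreeD (uv i Pi) _.
Qed.

Lemma agree_sum0 (I : Type) (r : seq I) (P : pred I) N (u : I -> symseries F) :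
  (forall i, P i -> agree N (u i) 0) -> agree N (\sum_(i <- r | P i) u i) 0.
Proof.
move=> u0; elim/big_rec: _ => // i x Pi x0.
by rewrite -[0]addr0; apply: agreeD; first exact: u0.
Qed.

Lemma ordM a b f g :
  agree a f 0 -> agree b g 0 -> agree (a + b) (f * g) 0.
Proof.
move=> f0 g0 d n dab; rewrite scompM big1 // => i _.
have [ia|ai] := ltnP i a; first by rewrite f0 // mul0r.
have id := ltn_ord i; rewrite g0 ?mulr0 //; lia.
Qed.

Lemma ordMl a f g : agree a f 0 -> agree a (f * g) 0.
Proof. by move=> f0; rewrite -[a]addn0; apply: ordM. Qed.

Lemma ordX a k f : agree a f 0 -> agree (a * k) (f ^+ k) 0.
Proof.
move=> f0; elim: k => [|k IH]; first by rewrite muln0.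
by rewrite exprS mulnS; apply: ordM.
Qed.

Lemma ordX1 k f : agree 1 f 0 -> agree k (f ^+ k) 0.
Proof. by move=> f0; have := ordX (k := k) f0; rewrite mul1n. Qed.

Lemma ordZ a (c : F) f : agree a f 0 -> agree a (c *: f) 0.
Proof. by move=> f0; rewrite -(scaler0 _ c); apply: agreeZ. Qed.

Lemma ord1P f : agree 1 f 0 <-> const_term f = 0.
Proof.
split=> [f0|f0 [|//] n _]; last by rewrite const_termE f0 mpolyC0.
by rewrite /const_term f0 // mcoeff0.
Qed.

Lemma const_termM f g : const_term (f * g) = const_term f * const_term g.
Proof.
rewrite {1}/const_term scompM big_ord1 /= !const_termE.
by rewrite -mpolyCM mcoeffC eqxx mulr1.
Qed.

Lemma const_termX f k : const_term (f ^+ k) = const_term f ^+ k.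
Proof.
elim: k => [|k IH]; last by rewrite !exprS const_termM IH.
by rewrite /const_term scomp1 eqxx mcoeff1 eqxx.
Qed.

Lemma const_termD f g : const_term (f + g) = const_term f + const_term g.
Proof. by rewrite /const_term scompD mcoeffD. Qed.

Lemma const_term1 : const_term (1 : symseries F) = 1.
Proof. by rewrite /const_term scomp1 eqxx mcoeff1 eqxx. Qed.

Lemma fsumE (u : nat -> symseries F) d n :
  fsum u d n = \sum_(k < d.+1) u k d n.
Proof. by rewrite /= scomp_sum. Qed.

Lemma eq_fsum (u v : nat -> symseries F) : u =1 v -> fsum u = fsum v.
Proof.
by move=> uv; apply: symseriesP => d n; rewrite !fsumE;
  apply: eq_bigr => k _; rewrite uv.
Qed.

Lemma fsumE_le (u : nat -> symseries F) d n M :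
  (forall k, agree k (u k) 0) -> (d < M)%N ->
  fsum u d n = \sum_(k < M) u k d n.
Proof. by move=> u0 dM; rewrite -scomp_sum (fsum_cvg u0 dM). Qed.

Lemma ord_fsum N (u : nat -> symseries F) :
  (forall k, agree N (u k) 0) -> agree N (fsum u) 0.
Proof. by move=> u0 d n dN; rewrite fsumE big1 // => k _; apply: u0. Qed.

Lemma fsum_diag (u : nat -> symseries F) d n :
  (forall k m, k != m -> u k m n = 0) -> fsum u d n = u d d n.
Proof.
move=> u0; rewrite fsumE (bigD1 ord_max) //= big1 ?addr0 // => i id.
by apply: u0.
Qed.

Lemma fsum_odd (u : nat -> symseries F) :
  (forall k, agree k (u k) 0) ->
  fsum (fun k => u (2 * k + 1)%N) = fsum (fun k => if odd k then u k else 0).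
Proof.
move=> u0; apply: symseriesP => d n.
(* The first d + 1 terms on the left use odd indices below 2 (d + 1), so the sum on the right is cut
   there instead of at d + 1. *)
rewrite fsumE (@fsumE_le _ d n (2 * d.+1)); last first.
- by lia.
- by move=> k; case: odd.
elim: d.+1 => [|m IH]; first by rewrite muln0 !big_ord0.
rewrite big_ord_recr /= IH mulnS add2n !big_ord_recr /= mul2n odd_double /=.
by rewrite addr0 addn1.
Qed.

Lemma fsum_even (u : nat -> symseries F) :
  (forall k, agree k (u k) 0) ->
  fsum (fun k => u (2 * k)%N) = fsum (fun k => if odd k then 0 else u k).
Proof.
move=> u0; apply: symseriesP => d n.
rewrite fsumE (@fsumE_le _ d n (2 * d.+1)); last first.
- by lia.
- by move=> k; case: odd.
elim: d.+1 => [|m IH]; first by rewrite muln0 !big_ord0.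
rewrite big_ord_recr /= IH mulnS add2n !big_ord_recr /= mul2n odd_double /=.
by rewrite addr0.
Qed.

(** Continuity reduces the claim to a partial sum; [maxn M N] terms approximate both [fsum u] and
    the sum of the images. *)
Lemma scontinuous_fsum (phi : {lrmorphism symseries F -> symseries F})
    (u : nat -> symseries F) :
  scontinuous phi -> (forall k, agree k (u k) 0) ->
  (forall k, agree k (phi (u k)) 0) ->
  phi (fsum u) = fsum (fun k => phi (u k)).
Proof.
move=> phic u0 pu0; apply: agree_eq => N.
have [M HM] := phic (fsum u) N.
have H := fsum_cvg u0 (leq_maxl M N).
apply: agree_trans (HM _ (agree_sym H)) _.
by rewrite raddf_sum; apply: (fsum_cvg pu0); rewrite leq_maxr.
Qed.

(** The powers of f tend to 0, so by continuity some power of [phi f] has constant term 0; a field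
    has no nilpotents. *)
Lemma scontinuous_const0 (phi : {lrmorphism symseries F -> symseries F}) f :
  scontinuous phi -> agree 1 f 0 -> agree 1 (phi f) 0.
Proof.
move=> phic f0; have [M HM] := phic 0 1%N.
have := HM (f ^+ M) (agree_sym (ordX1 (k := M) f0)).
rewrite raddf0 rmorphXn => /agree_sym /ord1P /eqP.
by rewrite const_termX expf_eq0 => /andP[_ /eqP] /ord1P.
Qed.

Lemma fsumZ (c : F) (u : nat -> symseries F) :
  c *: fsum u = fsum (fun k => c *: u k).
Proof.
apply: symseriesP => d n; rewrite scompZ !fsumE scaler_sumr.
by apply: eq_bigr.
Qed.

(** Regrouping of a double series along n = i j. The order bound leaves finitely many pairs in each
    degree. The vanishing at i = 0 and j = 0 settles the pairs that no n > 0 reaches, and the value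
    [divisors 0 = [:: 1]]. *)
Lemma fsum_divisors (a : nat -> nat -> symseries F) :
  (forall i j, agree (i * j) (a i j) 0) ->
  (forall j, a 0%N j = 0) -> (forall i, a i 0%N = 0) ->
  fsum (fun n => \sum_(d <- divisors n) a d (n %/ d)%N) =
  fsum (fun i => fsum (a i)).
Proof.
move=> ord a0 a0'; apply: symseriesP => d n.
have fE i : fsum (a i) d n = \sum_(j < d.+1) a i j d n by rewrite fsumE.
rewrite !fsumE (eq_bigr _ (fun (i : 'I_d.+1) _ => fE i)) {fE}.
have dE (k : 'I_d.+1) :
    (\sum_(i <- divisors k) a i (k %/ i)%N) d n =
    \sum_(i < d.+1 | (i %| k)%N && (0 < k)%N) a i (k %/ i)%N d n.
  have -> (r : seq nat) (v : nat -> symseries F) :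
      (\sum_(i <- r) v i) d n = \sum_(i <- r) v i d n.
    by elim: r => [|i r IH]; rewrite ?big_nil // !big_cons scompD IH.
  have [->|k0] := posnP k.
    rewrite (_ : divisors 0 = [:: 1%N]) // big_seq1 a0' big_pred0 // => i.
    by rewrite andbF.
  rewrite (eq_bigl (fun i : 'I_d.+1 => (i %| k)%N)); last first.
    by move=> i; rewrite ?andbT.
  rewrite -(big_mkord (fun i => i %| k)%N (fun i => a i (k %/ i)%N d n)).
  rewrite -big_filter; apply: perm_big; apply: uniq_perm.
  - exact: divisors_uniq.
  - by rewrite filter_uniq ?iota_uniq.
  move=> i; rewrite mem_filter mem_index_iota -dvdn_divisors //.
  case: (boolP (i %| k)%N) => //= /dvdn_leq; have := ltn_ord k; lia.
rewrite (eq_bigr _ (fun (k : 'I_d.+1) _ => dE k)) {dE}.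
rewrite (exchange_big_dep predT) //=.
apply: eq_bigr => i _.
have [i0|i0] := posnP i.
  rewrite i0 !big1 // => [j _|j /andP[]]; first by rewrite a0.
  by rewrite dvd0n => /eqP ->.
rewrite [RHS](bigID (fun j : 'I_d.+1 => (0 < j)%N && (i * j < d.+1)%N)) /=.
rewrite [X in _ = _ + X]big1 ?addr0; last first.
  move=> j; rewrite negb_and -!leqNgt leqn0 => /orP[/eqP ->|ij].
    by rewrite a0'.
  by rewrite ord.
(* For fixed i > 0 the two sums are matched by k = i j: [h] divides by i and [h'] multiplies by i,
   and [h'] undoes [h] on the multiples of i. *)
pose h (k : 'I_d.+1) : 'I_d.+1 := inord (k %/ i).
have hE (k : 'I_d.+1) : h k = (k %/ i)%N :> nat.
  by rewrite inordK //; apply: leq_ltn_trans (leq_div _ _) _.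
pose h' (k : 'I_d.+1) : 'I_d.+1 := inord (i * k).
rewrite [RHS](reindex_onto h h'); last first.
  move=> j /andP[j0 jd]; apply: val_inj; rewrite /= hE inordK //.
  by rewrite mulKn.
apply: eq_big => [k|k _]; last by rewrite hE.
rewrite hE; apply/andP/andP => [[/dvdnP[q kq] k0]|[/andP[q0 qd] /eqP e]].
  have kd := ltn_ord k.
  rewrite kq mulnK //; split; last first.
    by apply/eqP/val_inj; rewrite /h' /= inordK hE kq mulnK // mulnC // -kq.
  by apply/andP; nia.
have := congr1 val e; rewrite /h' /= inordK hE // => <-; split.
  by rewrite dvdn_mulr.
by rewrite muln_gt0 i0.
Qed.

End Agree.

(** * Newton's identities *)

Section Newton.
Variable F : fieldType.

(** With y the last variable, the generating functions satisfy E_(n+1)(t) = (1 + y t) E_n(t), and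
    the powers of y on the left are the expansion of y / (1 + y t). *)
Lemma mesym_last n k :
  \sum_(i < k.+1) (-1) ^+ i * 'X_ord_max ^+ i.+1 * mesym n.+1 F (k - i) =
  'X_ord_max * mwiden (mesym n F k).
Proof.
elim: k => [|k IH].
  by rewrite big_ord1 /= !mesym0E mwiden1 expr0 mul1r expr1.
rewrite big_ord_recl expr0 mul1r expr1 subn0 mesymSS mulrDr.
rewrite (eq_bigr (fun i : 'I_k.+1 => - ('X_ord_max * ((-1) ^+ i *
  'X_ord_max ^+ i.+1 * mesym n.+1 F (k - i))))); last first.
  by move=> i _; rewrite lift0 subSS !exprS; ring.
by rewrite sumrN -mulr_sumr IH; ring.
Qed.

(** Induction on the number of variables. The powers of the last variable sum up by [mesym_last];
    the remaining terms, expanded by the recurrence [mesymSS], give the identities of two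
    consecutive indices in n variables. *)
Lemma newton_mesym n k :
  k%:R * mesym n F k =
  \sum_(i < k) (-1) ^+ i * (\sum_(j < n) 'X_j ^+ i.+1) * mesym n F (k.-1 - i).
Proof.
case: k => [|k] /=; first by rewrite big_ord0 mul0r.
elim: n k => [|n IH] k.
  rewrite mesym_geqnE // mulr0 big1 // => i _.
  by rewrite big_ord0 mulr0 mul0r.
under eq_bigr => i _.
  rewrite big_ord_recr /= mulrDr mulrDl.
  rewrite (_ : \sum_(j < n) 'X_(widen_ord _ j) ^+ i.+1 =
     mwiden (\sum_(j < n) 'X_j ^+ i.+1)); last first.
    rewrite raddf_sum; apply: eq_bigr => j _.
    by rewrite /= rmorphXn /= mwidenX mnmwiden1.
  over.
rewrite big_split /= mesym_last.
pose u m i : {mpoly F[n]} :=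
  (-1) ^+ i * (\sum_(j < n) 'X_j ^+ i.+1) * mesym n F (m - i).
have IH0 : k%:R * mesym n F k = \sum_(i < k) u k.-1 i.
  by case: k => [|k]; rewrite ?mul0r ?big_ord0 ?IH.
have -> : \sum_(i < k.+1)
     (-1) ^+ i * mwiden (\sum_(j < n) 'X_j ^+ i.+1) * mesym n.+1 F (k - i) =
  mwiden (\sum_(i < k.+1) u k i) + 'X_ord_max * mwiden (\sum_(i < k) u k.-1 i).
  rewrite !big_ord_recr /= {2}/u subnn !mesym0E mulr1.
  rewrite rmorphD /= !rmorphM /= !rmorphXn /= rmorphN1 rmorph1 mulr1 addrAC.
  congr (_ + _).
  rewrite [mwiden _]raddf_sum [mwiden _]raddf_sum mulr_sumr -big_split /=.
  apply: eq_bigr => i _; rewrite /u !rmorphM /= !rmorphXn /= rmorphN1.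
  have -> : (k - i = (k.-1 - i).+1)%N by have := ltn_ord i; lia.
  by rewrite mesymSS; ring.
by rewrite -IH0 -IH mesymSS !rmorphM /= !rmorph_nat -natr1; ring.
Qed.

End Newton.

Section Newton2.
Variable F : fieldType.

Lemma scompM_homog (f g : symseries F) (a b d n : nat) :
  (forall j, j != a -> f j n = 0) -> (forall j, j != b -> g j n = 0) ->
  (f * g) d n = if d == (a + b)%N then f a n * g b n else 0.
Proof.
move=> f0 g0; rewrite scompM.
have z (i : 'I_d.+1) : (i != a :> nat) || (d != a + b)%N ->
    f i n * g (d - i)%N n = 0.
  have id := ltn_ord i.
  have [ia /= dab|ia _] := eqVneq (i : nat) a; last by rewrite f0 ?mul0r.
  by rewrite g0 ?mulr0 //; lia.
case: eqP => dab; last first.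
  by rewrite big1 // => i _; rewrite z //; apply/orP; right; apply/eqP.
have ad : (a < d.+1)%N by lia.
rewrite (bigD1 (Ordinal ad)) //= big1 ?addr0; last first.
  by move=> i ia; rewrite z // ia.
by rewrite dab addKn.
Qed.

Lemma newton_elemsym k :
  k%:R *: elemsym F k =
  \sum_(i < k) (-1) ^+ i *: (powersum F i.+1 * elemsym F (k.-1 - i)).
Proof.
apply: symseriesP => d n.
rewrite (scomp_sum
  (fun i => (-1) ^+ i *: (powersum F i.+1 * elemsym F (k.-1 - i)))).
have E (i : 'I_k) : ((-1) ^+ i *: (powersum F i.+1 * elemsym F (k.-1 - i))) d n
    = if d == k then
        (-1) ^+ i * (\sum_(j < n) 'X_j ^+ i.+1) * mesym n F (k.-1 - i)
      else 0.
  rewrite scompZ (scompM_homog (a := i.+1) (b := (k.-1 - i)%N)).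
  - have -> : (i.+1 + (k.-1 - i) = k)%N by have := ltn_ord i; lia.
    case: eqP => _; last by rewrite scaler0.
    by rewrite /= !eqxx -mulrA -signr_odd scaler_sign -signr_odd mulr_sign.
  - by move=> j /negPf /= ->.
  - by move=> j /negPf /= ->.
rewrite (eq_bigr _ (fun i _ => E i)) scompZ /=.
case: eqP => dk; last by rewrite scaler0 big1.
by rewrite -newton_mesym scaler_nat mulr_natl.
Qed.

End Newton2.

(** Course-of-values recursion, for sequences defined by Newton's identities: [step] receives a
    whole sequence but reads it only up to k. *)
Lemma strong_rec (T : Type) (x0 : T) (step : (nat -> T) -> nat -> T) :
  (forall f g k, (forall i, (i <= k)%N -> f i = g i) -> step f k = step g k) ->
  exists f, f 0%N = x0 /\ forall k, f k.+1 = step f k.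
Proof.
move=> stepP.
(* [L k] has its final values up to index k, so the diagonal solves the recursion. *)
pose fix L k := if k is k'.+1 then
    fun i => if (i <= k')%N then L k' i else step (L k') k'
  else fun _ => x0.
have LE k i : (i <= k)%N -> L k i = L i i.
  elim: k => [|k IH]; first by rewrite leqn0 => /eqP ->.
  rewrite leq_eqVlt => /predU1P[-> //|ik] /=.
  by rewrite -ltnS ik IH.
exists (fun k => L k k); split=> // k /=.
by rewrite ltnn; apply: stepP => i ik; rewrite LE.
Qed.

(** * Continuous homomorphisms with prescribed values on the e_k, then on the p_m *)

Section Exist.
Variable F : fieldType.
Hypothesis F0 : [pchar F] =i pred0.

Lemma natrF_neq0 k : (k.+1)%:R != 0 :> F.
Proof. by have /pcharf0P -> := F0. Qed.

Section EHom.
Implicit Types (f g : symseries F) (d n N : nat).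
Variable E : nat -> symseries F.
Hypothesis E0 : E 0%N = 1.
Hypothesis ordE : forall k, agree k (E k) 0.

(** The variable of index i stands for e_(i+1), whose prescribed image is [E i.+1]. *)
Definition eev n (t : {mpoly F[n]}) : symseries F :=
  mmap (GRing.in_alg (symseries F)) (fun i : 'I_n => E i.+1) t.

HB.instance Definition _ n := GRing.RMorphism.copy (@eev n)
  (mmap (GRing.in_alg (symseries F)) (fun i : 'I_n => E i.+1)).

Lemma eevZ n c (t : {mpoly F[n]}) : eev (c *: t) = c *: eev t.
Proof. by rewrite /eev mmapZ /= mulr_algl. Qed.

Lemma eevX n (i : 'I_n) : eev 'X_i = E i.+1.
Proof. by rewrite /eev mmapX mmap1U. Qed.

(** The weight [mnmwgt] counts the variable of index i with i + 1, the order guaranteed for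
    [E i.+1]. *)
Lemma eev_ord n d (t : {mpoly F[n]}) :
  t \is d.-homog for mnmwgt -> agree d (eev t) 0.
Proof.
move=> /dhomogP td; rewrite /eev /mmap big_seq; apply: agree_sum0 => m mt.
rewrite /= mulr_algl; apply: ordZ; rewrite /mmap1.
have <- : (\sum_(i : 'I_n) m i * i.+1)%N = d by exact: td.
elim: (index_enum _) => [|i r IH]; first by rewrite !big_nil.
by rewrite !big_cons; apply: ordM => //; rewrite mulnC; apply: ordX.
Qed.

Local Notation S n := [tuple mesym n F i.+1 | i < n].

(** The polynomial, isobaric of weight d, that expresses a component of f in e_1, ..., e_n by the
    fundamental theorem. *)
Definition ecoord (f : symseries F) d n : {mpoly F[n]} :=
  sval (sym_fundamental_homog (scomp_sym f d n) (scomp_homog f d n)).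

Lemma ecoordE f d n : ecoord f d n \mPo S n = f d n.
Proof. by rewrite /ecoord; case: sym_fundamental_homog => t []. Qed.

Lemma ecoord_homog f d n : ecoord f d n \is d.-homog for mnmwgt.
Proof. by rewrite /ecoord; case: sym_fundamental_homog => t []. Qed.

(** Algebraic independence of e_1, ..., e_n. It reduces identities between coordinates, such as
    additivity and multiplicativity, to identities between symmetric polynomials. *)
Lemma ecoord_eq f d n t : t \mPo S n = f d n -> ecoord f d n = t.
Proof. by move=> tf; apply: msym_fundamental_un; rewrite ecoordE. Qed.

(** Setting the last variable to 0 preserves e_1, ..., e_n and kills e_(n+1), so it acts on
    coordinates as [drop_last] again. *)
Lemma S_drop_last n : [tuple tnth (S n.+1) i \mPo drop_last F n | i < n.+1] =
  [tuple tnth (drop_last F n) i \mPo S n | i < n.+1].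
Proof.
apply: eq_from_tnth => i; rewrite !tnth_mktuple.
have := scomp_stable (elemsym F i.+1) i.+1 n; rewrite /= eqxx => ->.
case: unliftP => [j|] ->.
  by rewrite comp_mpolyXU -tnth_nth tnth_mktuple lift_max.
by rewrite comp_mpoly0 mesym_geqnE.
Qed.

Lemma comp_mpolyA n k l (p : {mpoly F[n]}) (u : n.-tuple {mpoly F[k]})
    (v : k.-tuple {mpoly F[l]}) :
  (p \mPo u) \mPo v = p \mPo [tuple tnth u i \mPo v | i < n].
Proof.
rewrite (comp_mpolyEX p u) (comp_mpolyEX p [tuple _ | i < n]) raddf_sum /=.
apply: eq_bigr => m _; rewrite comp_mpolyZ !comp_mpolyX rmorph_prod /=.
by congr (_ *: _); apply: eq_bigr => i _; rewrite tnth_mktuple rmorphXn.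
Qed.

Lemma ecoord_drop_last f d n :
  ecoord f d n.+1 \mPo drop_last F n = ecoord f d n.
Proof.
apply/esym/ecoord_eq.
by rewrite comp_mpolyA -S_drop_last -comp_mpolyA ecoordE scomp_stable.
Qed.

(* A monomial of weight d <= n does not contain the last variable, which has
   weight n.+1. *)
Lemma eev_ecoordS f d n : (d <= n)%N ->
  eev (ecoord f d n.+1) = eev (ecoord f d n).
Proof.
move=> dn; rewrite -[ecoord f d n]ecoord_drop_last.
have /dhomogP hom := ecoord_homog f d n.+1.
rewrite [X in _ = eev X]comp_mpolyEX raddf_sum {1}/eev /mmap.
rewrite big_seq [RHS]big_seq; apply: eq_bigr => m mt.
rewrite /= eevZ mulr_algl comp_mpolyX rmorph_prod; congr (_ *: _).
apply: eq_bigr => i _; rewrite rmorphXn.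
have [->|mi] := eqVneq (m i) 0%N; first by rewrite !expr0.
rewrite tnth_mktuple; case: unliftP => [j|] ij.
  rewrite /= eevX. by congr (E _.+1 ^+ _); rewrite ij lift_max.
have : (\sum_(j < n.+1) m j * j.+1)%N = d by exact: hom.
by rewrite (bigD1 i) //= {2}ij /=; have : (0 < m i)%N; [rewrite lt0n | nia].
Qed.

Lemma eev_ecoord f d n : (d <= n)%N -> eev (ecoord f d n) = eev (ecoord f d d).
Proof.
move=> dn; rewrite -(subnKC dn).
elim: (n - d)%N => [|m IH]; first by rewrite addn0.
by rewrite addnS eev_ecoordS ?IH // leq_addr.
Qed.

(** In degree d, d variables suffice: by [eev_ecoord] more of them give the same value. *)
Definition ehom (f : symseries F) : symseries F :=
  fsum (fun d => eev (ecoord f d d)).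

(** A common number of variables for all degrees below N, so that components of two series can be
    multiplied. *)
Lemma ehom_agree f N n : (N <= n.+1)%N ->
  agree N (ehom f) (\sum_(d < N) eev (ecoord f d n)).
Proof.
move=> Nn; apply: agree_sym.
rewrite (eq_bigr (fun d : 'I_N => eev (ecoord f d d))); last first.
  by move=> d _; rewrite eev_ecoord //; have := ltn_ord d; lia.
apply: (fsum_cvg (u := fun d => eev (ecoord f d d))) => // k.
exact/eev_ord/ecoord_homog.
Qed.

Lemma ecoordD f g d n : ecoord (f + g) d n = ecoord f d n + ecoord g d n.
Proof. by apply: ecoord_eq; rewrite raddfD /= !ecoordE. Qed.

Lemma ecoordZ c f d n : ecoord (c *: f) d n = c *: ecoord f d n.
Proof. by apply: ecoord_eq; rewrite comp_mpolyZ !ecoordE. Qed.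

Lemma ecoordM f g d n :
  ecoord (f * g) d n = \sum_(i < d.+1) ecoord f i n * ecoord g (d - i) n.
Proof.
apply: ecoord_eq; rewrite raddf_sum scompM /=; apply: eq_bigr => i _.
by rewrite rmorphM /= !ecoordE.
Qed.

Lemma ecoord1 d n : ecoord 1 d n = (d == 0%N)%:R.
Proof. by apply: ecoord_eq; rewrite rmorph_nat. Qed.

Fact ehom_linear : linear ehom.
Proof.
move=> c f g; apply: symseriesP => d n; rewrite scompD scompZ !fsumE.
rewrite scaler_sumr -big_split /=; apply: eq_bigr => k _.
by rewrite ecoordD ecoordZ raddfD /= eevZ.
Qed.

Fact ehom1 : ehom 1 = 1.
Proof.
apply: symseriesP => d n; rewrite fsumE big_ord_recl big1 => [|i _].
  by rewrite ecoord1 rmorph1 addr0.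
by rewrite ecoord1 rmorph0.
Qed.

Fact ehomM : {morph ehom : f g / f * g}.
Proof.
move=> f g; apply: agree_eq => N.
apply: agree_trans (ehom_agree _ (leqnSn N)) _.
apply: agree_sym.
have Nf := ehom_agree f (leqnSn N); have Ng := ehom_agree g (leqnSn N).
apply: agree_trans (agreeM Nf Ng) _.
(* An auxiliary variable, finally set to 1, records the degree. Below N the coefficients of the
   product [P f * P g] are the components of f g; from N on they have order at least N and are
   negligible. *)
pose a h i := eev (ecoord h i N).
pose P h := \poly_(i < N) a h i.
have P1 h : (P h).[1] = \sum_(i < N) a h i.
  by rewrite horner_poly; apply: eq_bigr => i _; rewrite expr1n mulr1.
have ordP h i : agree i (P h)`_i 0.
  by rewrite coef_poly; case: ifP => // _; apply/eev_ord/ecoord_homog.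
rewrite -(P1 f) -(P1 g) -hornerM (@horner_coef_wide _ (N + N)); last first.
  apply: leq_trans (size_polyMleq _ _) _.
  apply: leq_trans (leq_pred _) _.
  by apply: leq_add; apply: size_poly.
rewrite big_split_ord -[X in agree _ _ X]addr0; apply: agreeD; last first.
  apply: agree_sum0 => i _ /=; rewrite expr1n mulr1.
  apply: agree_le (leq_addr i N) _; rewrite coefM; apply: agree_sum0 => j _.
  by rewrite -{1}(subnKC (leq_ord j)); apply: ordM.
apply: agree_sum => i _ /=; rewrite expr1n mulr1 coefM ecoordM raddf_sum /=.
apply: agree_sum => j _; rewrite rmorphM /= !coef_poly.
have -> : (j < N)%N by apply: leq_trans (ltn_ord i).
by have -> : (i - j < N)%N by apply: leq_ltn_trans (leq_subr _ _) (ltn_ord i).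
Qed.

Lemma ehom_elemsym (k : nat) : ehom (elemsym F k) = E k.
Proof.
case: k => [|k].
  have -> : elemsym F 0 = 1.
    apply: symseriesP => d n; rewrite scomp1 /=.
    by case: eqP => // _; rewrite mesym0E.
  by rewrite ehom1 E0.
(* In k + 1 variables e_(k+1) is the last coordinate. [insub] forms the index k, whose bound is
   known only once d = k + 1. *)
have cE d : ecoord (elemsym F k.+1) d d =
    if d == k.+1 then if insub k is Some i then 'X_i else 0 else 0.
  apply: ecoord_eq; case: (eqVneq d k.+1) => [->|dk] /=; last first.
    by rewrite (negPf dk) comp_mpoly0.
  rewrite insubT //= => kk.
  by rewrite comp_mpolyXU -tnth_nth tnth_mktuple ?eqxx.
have uE d : eev (ecoord (elemsym F k.+1) d d) = if d == k.+1 then E d else 0.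
  rewrite cE; case: (eqVneq d k.+1) => [->|dk]; last by rewrite rmorph0.
  by rewrite insubT //= => kk; rewrite eevX.
apply: symseriesP => d n; rewrite (@fsumE_le _ _ _ _ (d + k.+2)).
- have kd : (k.+1 < d + k.+2)%N by lia.
  rewrite (bigD1 (Ordinal kd)) //= uE eqxx big1 ?addr0 // => i ik.
  by rewrite uE; case: eqP => // e; case/eqP: ik; apply: val_inj.
- by move=> i; rewrite uE; case: eqP.
- by lia.
Qed.

Lemma ehom_continuous : scontinuous ehom.
Proof.
move=> f N; exists N => g fg d n dN; rewrite !fsumE; apply: eq_bigr => k _.
have -> // : ecoord f k k = ecoord g k k.
apply: ecoord_eq; rewrite ecoordE fg //.
by apply: leq_ltn_trans dN; rewrite -ltnS.
Qed.

HB.instance Definition _ := GRing.isLinear.Build F _ _ _ ehom ehom_linear.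
HB.instance Definition _ :=
  GRing.isMonoidMorphism.Build _ _ ehom (conj ehom1 ehomM).

Definition ehom_lrmorphism : {lrmorphism symseries F -> symseries F} := ehom.

End EHom.

Lemma psum_hom_exists (G : nat -> symseries F) :
  (forall m, (0 < m)%N -> agree m (G m) 0) -> exists phi, psum_hom_spec G phi.
Proof.
move=> ordG.
(* [E] solves Newton's identities with [G] in place of the power sums; characteristic 0 will allow
   the division by k + 1 to be undone. *)
have [|E [E0 ES]] := @strong_rec _ (1 : symseries F) (fun E k => (k.+1)%:R^-1 *:
    \sum_(i < k.+1) (-1) ^+ i *: (G i.+1 * E (k - i)%N)).
  move=> f g k fg; congr (_ *: _); apply: eq_bigr => i _.
  by rewrite fg // leq_subr.
have ordE k : agree k (E k) 0.
  elim/ltn_ind: k => -[|k] // IH; rewrite ES; apply/ordZ/agree_sum0 => i _.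
  apply: ordZ; apply: (@agree_le _ _ (i.+1 + (k - i))).
    by have := ltn_ord i; lia.
  by apply: ordM; [apply: ordG | apply: IH; rewrite ltnS leq_subr].
exists (ehom_lrmorphism ordE); split; first exact: ehom_continuous.
(* In the image of Newton's identity for e_(m+1) all terms but that of p_(m+1) are known by
   induction. Comparison with the recursion for [E] leaves the two last terms, with the same
   sign. *)
elim/ltn_ind => -[|m] // IH _.
have := congr1 (ehom_lrmorphism ordE) (newton_elemsym F m.+1).
rewrite linearZ /= ehom_elemsym // ES scalerA divff ?natrF_neq0 // scale1r.
rewrite raddf_sum /= !big_ord_recr /= subnn E0 mulr1.
rewrite linearZ /= rmorphM /= ehom_elemsym // E0 mulr1.
rewrite [X in X + _ = _ -> _](_ : _ = \sum_(i < m)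
   ehom E ((-1) ^+ i *: (powersum F i.+1 * elemsym F (m - i)))); last first.
  apply: eq_bigr => i _; rewrite linearZ /= rmorphM /= ehom_elemsym //.
  by have /= -> := IH i.+1 _ isT; rewrite ?ltnS.
move=> /addrI /(congr1 (fun x => (-1) ^+ m *: x)).
by rewrite !scalerA -expr2 sqrr_sign !scale1r.
Qed.

End Exist.

(** * The Möbius function *)

Section Moebius.

(** If p divides e, then p has exponent at least 2 in p e; otherwise p is one new prime and the
    other exponents do not change. *)
Lemma moebius_primeM p e : prime p -> (0 < e)%N ->
  moebius (p * e) = if (p %| e)%N then 0 else - moebius e.
Proof.
move=> pp e0; have p0 := prime_gt0 pp.
have pin q : (q \in primes (p * e)) = (q == p) || (q \in primes e).
  by rewrite primesM // primes_prime // inE.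
rewrite /moebius; case: (boolP (p %| e)%N) => pe.
  case: allP => // /(_ p); rewrite pin eqxx => /(_ isT).
  rewrite lognM // logn_prime // eqxx add1n eqSS.
  by rewrite eqn0Ngt logn_gt0 mem_primes pp e0 pe.
have perm : perm_eq (primes (p * e)) (p :: primes e).
  apply: uniq_perm; rewrite ?primes_uniq //= ?primes_uniq ?andbT //.
  by rewrite mem_primes (negPf pe) !andbF.
rewrite (perm_all _ perm) (perm_size perm) /= lognM // logn_prime // eqxx.
rewrite (_ : logn p e = 0%N) /=; last first.
  by apply/eqP; rewrite -leqn0 leqNgt logn_gt0 mem_primes (negPf pe) !andbF.
rewrite (_ : all _ (primes e) = all (fun q => logn q e == 1%N) (primes e)).
  by case: all; rewrite ?oppr0 // exprS mulN1r.
apply: eq_in_all => q; rewrite mem_primes => /and3P[qp _ qe].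
rewrite lognM // logn_prime //; case: (eqVneq q p) => // qep.
by rewrite -qep qe in pe.
Qed.

(** For n = p m with p prime, the divisors of n are the p e with e dividing m, and the divisors e of
    m prime to p. The terms of p e and e cancel when p does not divide e, and that of p e is 0
    otherwise. *)
Lemma sum_moebius n : (0 < n)%N ->
  \sum_(d <- divisors n) moebius d = (n == 1%N)%:R.
Proof.
move=> n0; have [->|n1] := eqVneq n 1%N; first by rewrite big_seq1.
have n2 : (1 < n)%N by lia.
have pp := pdiv_prime n2; set p := pdiv n in pp.
have [m nE] : exists m, n = (p * m)%N.
  by have /dvdnP[m ->] := pdiv_dvd n; exists m; rewrite mulnC.
have p0 := prime_gt0 pp.
have m0 : (0 < m)%N by move: n0; rewrite nE muln_gt0 => /andP[].
rewrite (bigID (fun d : nat => (p %| d)%N)) /=.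
rewrite -big_filter -[X in _ + X]big_filter.
have /(perm_big _) -> : perm_eq [seq d <- divisors n | (p %| d)%N]
    [seq (p * e)%N | e <- divisors m].
  apply: uniq_perm; first by rewrite filter_uniq ?divisors_uniq.
    rewrite map_inj_uniq ?divisors_uniq // => x y /eqP.
    by rewrite eqn_pmul2l // => /eqP.
  move=> d; rewrite mem_filter -dvdn_divisors //; apply/andP/mapP.
    move=> [/dvdnP[e ->]]; rewrite nE mulnC dvdn_pmul2l // => em.
    by exists e; rewrite // -dvdn_divisors.
  move=> [e]; rewrite -dvdn_divisors // => em ->; split; first exact: dvdn_mulr.
  by rewrite nE dvdn_pmul2l.
have /(perm_big _) -> : perm_eq [seq d <- divisors n | ~~ (p %| d)%N]
    [seq d <- divisors m | ~~ (p %| d)%N].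
  apply: uniq_perm; rewrite ?filter_uniq ?divisors_uniq // => d.
  rewrite !mem_filter -!dvdn_divisors //; case: (boolP (p %| d)%N) => //= pd.
  by rewrite nE Gauss_dvdr // coprime_sym prime_coprime.
rewrite big_map big_filter [X in _ + X]big_mkcond -big_split /= big_seq big1 //.
move=> e; rewrite -dvdn_divisors // => /dvdn_gt0 -/(_ m0) e0.
by rewrite moebius_primeM //; case: ifP => _ /=; rewrite ?addr0 ?addNr.
Qed.

End Moebius.

(** * The character modulo 4 *)

Section Chi.
Variable F : fieldType.

(** The nonprincipal Dirichlet character modulo 4; also the imaginary part of the k-th power of the
    imaginary unit. *)
Definition chi (k : nat) : F := if odd k then (-1) ^+ k./2 else 0.

Lemma chiSS k : chi k.+2 = - chi k.
Proof. by rewrite /chi /= negbK; case: ifP; rewrite ?oppr0 // exprS mulN1r. Qed.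

(* As chi k = sin (k pi / 2) and chi k.+1 = cos (k pi / 2), this is the addition
   formula for sin (i pi - (i + j) pi / 2). *)
Lemma chi_sub i j :
  chi i * chi j.+1 - chi i.+1 * chi j = - (-1) ^+ i * chi (i + j).
Proof.
suff H k : chi k * chi j.+1 - chi k.+1 * chi j = - (-1) ^+ k * chi (k + j) /\
  chi k.+1 * chi j.+1 - chi k.+2 * chi j = - (-1) ^+ k.+1 * chi (k.+1 + j).
  by case: (H i).
elim: k => [|k [IH1 IH2]].
  rewrite chiSS add0n add1n (_ : chi 0 = 0) // (_ : chi 1 = 1) //.
  by rewrite expr0 expr1; split; ring.
split=> //; rewrite !addSn !chiSS !exprS.
have -> : - chi k * chi j.+1 - - chi k.+1 * chi j =
   - (chi k * chi j.+1 - chi k.+1 * chi j) by ring.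
by rewrite IH1; ring.
Qed.

(** For i = 2a + 1 and j = 2b + 1 the half of i j is a + b + 2ab, of the same parity as a + b. *)
Lemma chiM i j : chi (i * j) = chi i * chi j.
Proof.
rewrite /chi oddM; case oi: (odd i); case oj: (odd j);
  rewrite ?mulr0 ?mul0r //=.
rewrite -exprD -signr_odd -[RHS]signr_odd; congr (_ ^+ nat_of_bool _).
rewrite -{1}(odd_double_half i) -{1}(odd_double_half j) oi oj.
have -> : ((1 + i./2.*2) * (1 + j./2.*2) =
  (i./2 + j./2 + (i./2 * j./2).*2).*2.+1)%N by lia.
by rewrite -add1n /= uphalf_double oddD odd_double addbF.
Qed.

Definition chiV (k : nat) : F := chi k / k%:R.

Lemma chiVM i j : chiV (i * j) = chiV i * chiV j.
Proof. by rewrite /chiV chiM natrM invfM mulrACA. Qed.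

Lemma chiV0 : chiV 0 = 0. Proof. by rewrite /chiV mul0r. Qed.
Lemma chiV1 : chiV 1 = 1. Proof. by rewrite /chiV divr1. Qed.

End Chi.

(** * The Euler derivation *)

Section Euler.
Variable F : fieldType.
Implicit Types f g h : symseries F.

Program Definition euler f : symseries F :=
  @SymSeries F (fun d n => d%:R *: f d n) _ _ _.
Next Obligation. by rewrite rpredZ ?scomp_homog. Qed.
Next Obligation. by rewrite rpredZ ?scomp_sym. Qed.
Next Obligation. by rewrite comp_mpolyZ scomp_stable. Qed.

Lemma eulerE f d n : euler f d n = d%:R *: f d n. Proof. by []. Qed.

Lemma eulerZ c f : euler (c *: f) = c *: euler f.
Proof.
by apply: symseriesP => d n; rewrite eulerE !scompZ eulerE !scalerA mulrC.
Qed.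

Lemma eulerM f g : euler (f * g) = euler f * g + f * euler g.
Proof.
apply: symseriesP => d n; rewrite scompD eulerE !scompM scaler_sumr -big_split.
apply: eq_bigr => i _ /=; rewrite -scalerAl -scalerAr -scalerDl -natrD.
by rewrite subnKC // -ltnS.
Qed.

Lemma eulerX f k : euler (f ^+ k) = k%:R *: (f ^+ k.-1 * euler f).
Proof.
elim: k => [|k IH].
  rewrite scale0r; apply: symseriesP => d n; rewrite eulerE scomp1.
  by case: d => [|d]; rewrite ?scale0r ?scaler0.
rewrite exprS eulerM IH -scalerAr mulrA -natr1 scalerDl scale1r /= addrC.
case: k {IH} => [|k]; first by rewrite !scale0r [_ * f ^+ 0]mulrC.
by rewrite -exprS [_ * f ^+ _]mulrC.
Qed.

Lemma euler_fsum (u : nat -> symseries F) :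
  euler (fsum u) = fsum (fun k => euler (u k)).
Proof.
apply: symseriesP => d n; rewrite eulerE !fsumE scaler_sumr.
by apply: eq_bigr.
Qed.

Lemma euler_ord f : agree 1 (euler f) 0.
Proof. by case=> // n _; rewrite eulerE scale0r. Qed.

Lemma euler_inj f g : [pchar F] =i pred0 ->
  const_term f = const_term g -> euler f = euler g -> f = g.
Proof.
move=> F0 fg0 fg; apply: symseriesP => -[|d] n.
  by rewrite !const_termE fg0.
have := congr1 (fun h : symseries F => h d.+1 n) fg; rewrite /= => /scalerI.
by apply; apply: natrF_neq0.
Qed.

End Euler.

(** * The arctangent series *)

Section Atan.
Variable F : fieldType.
Implicit Types f g h x y : symseries F.

Definition arctan x : symseries F := fsum (fun k => chiV F k *: x ^+ k).

Lemma ord_arctan m x : agree m x 0 -> agree m (arctan x) 0.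
Proof.
move=> x0; apply: ord_fsum => -[|k]; first by rewrite chiV0 scale0r.
by apply: ordZ; rewrite exprS; apply: ordMl.
Qed.

Lemma arctan_ord1 x k : agree 1 x 0 -> agree k (chiV F k *: x ^+ k) 0.
Proof. by move=> x0; apply/ordZ/ordX1. Qed.

Lemma scontinuous_arctan (phi : {lrmorphism symseries F -> symseries F}) x :
  scontinuous phi -> agree 1 x 0 -> phi (arctan x) = arctan (phi x).
Proof.
move=> phic x0; have px0 := scontinuous_const0 phic x0.
rewrite /arctan scontinuous_fsum // => [|k|k].
- by apply: eq_fsum => k; rewrite linearZ /= rmorphXn.
- exact: arctan_ord1.
- by rewrite linearZ /= rmorphXn; apply: arctan_ord1.
Qed.

(* The terms of degree k >= 2 of the arctangent series depend in degree d only
   on the terms of x of degree less than d, so arctan x determines x. *)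
Lemma arctan_inj N x y : agree 1 x 0 -> agree 1 y 0 ->
  agree N (arctan x) (arctan y) -> agree N x y.
Proof.
move=> x0 y0 xy; elim: N xy => [//|N IH] xy.
have {}IH := IH (agree_le (leqnSn N) xy).
have tail k : agree N.+1 (x ^+ k.+2) (y ^+ k.+2).
  apply/agree_subr0.
  have Nk : agree N (x ^+ k.+1) (y ^+ k.+1).
    by elim: (k.+1) => // m IHm; rewrite !exprS; apply: agreeM.
  rewrite exprS [y ^+ _]exprS.
  have -> : x * x ^+ k.+1 - y * y ^+ k.+1 =
     (x - y) * x ^+ k.+1 + y * (x ^+ k.+1 - y ^+ k.+1) by ring.
  rewrite -[X in agree _ _ X]addr0; apply: agreeD.
    rewrite -addn1; apply: ordM; first exact/agree_subr0.
    by rewrite exprS; apply: ordMl.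
  by rewrite -add1n; apply: ordM => //; apply/agree_subr0.
have arctanE z d n : (arctan z) d.+1 n = z d.+1 n +
    \sum_(k < d) (chiV F k.+2 *: z ^+ k.+2) d.+1 n.
  rewrite fsumE big_ord_recl big_ord_recl /= chiV0 chiV1 !scale0r add0r scale1r.
  by rewrite expr1; congr (_ + _); apply: eq_bigr.
move=> [|d] n dN; first by rewrite x0 ?y0.
have := xy d.+1 n dN; rewrite !arctanE.
rewrite (eq_bigr (fun k : 'I_d => (chiV F k.+2 *: y ^+ k.+2) d.+1 n)).
  exact: addIr.
by move=> k _; rewrite !scompZ tail.
Qed.

Hypothesis F0 : [pchar F] =i pred0.

(** D atan x = D x / (1 + x^2), cleared of the denominator: the coefficients chi(k) make the
    derivative a geometric series in - x^2. *)
Lemma euler_arctan x : agree 1 x 0 -> euler (arctan x) * (1 + x ^+ 2) = euler x.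
Proof.
move=> x0; rewrite /arctan euler_fsum.
pose u k := chi F k *: (x ^+ k.-1 * euler x).
rewrite (@eq_fsum _ _ u); last first.
  move=> k; rewrite eulerZ eulerX scalerA /u /chiV.
  case: k => [|k]; first by rewrite mulr0.
  by rewrite divfK // natrF_neq0.
have ordu k : agree k (u k) 0.
  case: k => // k; apply: ordZ; apply: (@agree_le _ _ (k + 1)).
    by rewrite addn1.
  by apply: ordM; [apply: ordX1 | apply: euler_ord].
have uodd N : u (2 * N).+1 = (- x ^+ 2) ^+ N * euler x.
  rewrite /u /chi /= mul2n odd_double /= uphalf_double -mul2n exprM.
  rewrite [in RHS]exprNn scalerAl -signr_odd scaler_sign.
  by rewrite -signr_odd mulr_sign.
have ueven N : u (2 * N)%N = 0.
  by rewrite /u /chi mul2n odd_double scale0r.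
have finite N : (\sum_(k < (2 * N).+1) u k) * (1 + x ^+ 2) =
    (1 - (- x ^+ 2) ^+ N) * euler x.
  elim: N => [|N IH].
    by rewrite big_ord1 (ueven 0%N) mul0r expr0 subrr mul0r.
  rewrite mulnS add2n big_ord_recr big_ord_recr /= mulrDl mulrDl IH uodd.
  have -> : (2 * N).+2 = (2 * N.+1)%N by lia.
  by rewrite ueven [_ ^+ N.+1]exprS; move: (_ ^+ N) => y; ring.
apply: agree_eq => N.
(* The remainder (- x^2)^N D x of the geometric sum has order at least N. *)
have le : (N <= (2 * N).+1)%N by lia.
have close := agree_sym (fsum_cvg ordu le).
apply: agree_trans (agreeM close (@agree_refl _ N _)) _.
rewrite finite mulrBl mul1r -[X in agree _ _ X]subr0.
apply/agree_subr0; rewrite subr0 addrAC subrr add0r -scaleN1r; apply: ordZ.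
apply/ordMl/ordX1; rewrite -scaleN1r; apply: ordZ.
by rewrite expr2; apply: ordMl.
Qed.

End Atan.

(** * The quotient of elementary symmetric functions as a tangent *)

Section Tangent.
Variable F : fieldType.
Hypothesis F0 : [pchar F] =i pred0.

Lemma elemsym_ord k : agree k (elemsym F k) 0.
Proof. by move=> d n dk; rewrite /= ltn_eqF. Qed.

Lemma powersum_ord k : agree k (powersum F k) 0.
Proof. by move=> d n dk; rewrite /= ltn_eqF. Qed.

(** With i^2 = -1, the product of all 1 + i x_j is the sum of the i^k e_k; its real part is
    [even_elemsym] and its imaginary part [odd_elemsym]. Its logarithmic Euler derivative is
    [even_psum] + i [odd_psum]. *)
Definition odd_elemsym : symseries F :=
  fsum (fun k => chi F k *: elemsym F k).
Definition even_elemsym : symseries F :=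
  fsum (fun k => chi F k.+1 *: elemsym F k).
Definition odd_psum : symseries F :=
  fsum (fun k => chi F k *: powersum F k).
Definition even_psum : symseries F :=
  fsum (fun k => - chi F k.+1 *: powersum F k).

Lemma odd_elemsymE :
  fsum (fun n : nat => (-1) ^+ n *: elemsym F (2 * n + 1)) = odd_elemsym.
Proof.
pose u k := (-1) ^+ k./2 *: elemsym F k.
rewrite (@eq_fsum _ _ (fun n => u (2 * n + 1)%N)); last first.
  by move=> k; rewrite /u addn1 mul2n /= uphalf_double.
rewrite fsum_odd => [|k]; last exact/ordZ/elemsym_ord.
by apply: eq_fsum => k; rewrite /u /chi; case: ifP; rewrite ?scale0r.
Qed.

Lemma even_elemsymE :
  fsum (fun n : nat => (-1) ^+ n *: elemsym F (2 * n)) = even_elemsym.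
Proof.
pose u k := (-1) ^+ k./2 *: elemsym F k.
rewrite (@eq_fsum _ _ (fun n => u (2 * n)%N)); last first.
  by move=> k; rewrite /u mul2n doubleK.
rewrite fsum_even => [|k]; last exact/ordZ/elemsym_ord.
apply: eq_fsum => k; rewrite /u /chi /= uphalf_half.
by case: odd; rewrite ?scale0r.
Qed.

Lemma fsum_elemsym (c : nat -> F) d n :
  fsum (fun k => c k *: elemsym F k) d n = c d *: mesym n F d.
Proof.
rewrite fsum_diag ?scompZ /= ?eqxx // => k m km.
by rewrite eq_sym (negPf km) scaler0.
Qed.

Lemma fsum_powersum (c : nat -> F) d n :
  fsum (fun k => c k *: powersum F k) d n = c d *: powersum F d d n.
Proof.
rewrite fsum_diag ?scompZ // => k m km.
by rewrite /= eq_sym (negPf km) scaler0.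
Qed.

(** When the coefficients combine as in the hypothesis, the component of degree d is c(d) times
    Newton's identity. The derivatives of the real and the imaginary part are both instances. *)
Lemma euler_elemsym (a b a' b' c : nat -> F) :
  (forall i j, a i * b j + a' i * b' j = - (-1) ^+ i * c (i + j)%N) ->
  euler (fsum (fun k => c k *: elemsym F k)) =
  fsum (fun k => a k *: powersum F k) * fsum (fun k => b k *: elemsym F k) +
  fsum (fun k => a' k *: powersum F k) * fsum (fun k => b' k *: elemsym F k).
Proof.
move=> abc; apply: symseriesP => d n.
rewrite eulerE fsum_elemsym scompD !scompM -big_split /=.
have -> : \sum_(i < d.+1)
    (fsum (fun k => a k *: powersum F k) i n *
       fsum (fun k => b k *: elemsym F k) (d - i)%N n +
     fsum (fun k => a' k *: powersum F k) i n *
       fsum (fun k => b' k *: elemsym F k) (d - i)%N n) =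
  \sum_(i < d.+1) (- (-1) ^+ i * c d) *:
     (powersum F i i n * mesym n F (d - i)).
  apply: eq_bigr => i _; rewrite !fsum_powersum !fsum_elemsym.
  rewrite -!scalerAl -!scalerAr !scalerA -scalerDl abc subnKC //.
  by rewrite -ltnS.
(* The term of index 0 vanishes because p_0 is set to 0; the shift of the index then turns -
   (-1)^(i+1) into Newton's sign (-1)^i. *)
rewrite big_ord_recl /= mul0r scaler0 add0r.
rewrite -(mulr1 (mesym n F d)) !scalerA.
have -> : (d%:R * c d) *: (mesym n F d * 1) = c d *: (d%:R * mesym n F d).
  by rewrite mulr1 mulrC -scalerA scaler_nat mulr_natl.
rewrite newton_mesym scaler_sumr; apply: eq_bigr => i _.
rewrite /= eqxx /bump /= add1n.
have -> : - (-1) ^+ i.+1 * c d = c d * (-1) ^+ i.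
  by rewrite exprS mulN1r opprK mulrC.
rewrite -scalerA; congr (_ *: _).
have -> : (d - i.+1 = d.-1 - i)%N by lia.
by rewrite -mulrA -[in RHS]signr_odd scaler_sign -[in LHS]signr_odd mulr_sign.
Qed.

Lemma euler_odd_elemsym :
  euler odd_elemsym = odd_psum * even_elemsym + even_psum * odd_elemsym.
Proof.
by apply: euler_elemsym => i j; rewrite -chi_sub mulNr.
Qed.

Lemma euler_even_elemsym :
  euler even_elemsym = even_psum * even_elemsym - odd_psum * odd_elemsym.
Proof.
rewrite addrC -mulNr.
have -> : - odd_psum = fsum (fun k => - chi F k *: powersum F k).
  rewrite -scaleN1r fsumZ; apply: eq_fsum => k.
  by rewrite scalerA mulN1r.
apply: euler_elemsym => i j.
by rewrite -addnS -chi_sub chiSS; ring.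
Qed.

Lemma const_even_elemsym : const_term even_elemsym = 1.
Proof.
rewrite /const_term fsum_elemsym mesym0E /chi /= scale1r.
by rewrite mcoeff1 eqxx.
Qed.

Lemma const_odd_elemsym : const_term odd_elemsym = 0.
Proof. by rewrite /const_term fsum_elemsym /chi /= scale0r mcoeff0. Qed.

Definition tan_psum : symseries F := odd_elemsym / even_elemsym.

Lemma even_elemsym_unit : even_elemsym \is a GRing.unit.
Proof. exact/const_term1_unit/const_even_elemsym. Qed.

Lemma const_tan_psum : const_term tan_psum = 0.
Proof.
have := const_termM tan_psum even_elemsym.
rewrite /tan_psum divrK ?even_elemsym_unit //.
by rewrite const_even_elemsym const_odd_elemsym mulr1.
Qed.

(** The quotient rule, multiplied by the denominator; the terms with [even_psum] cancel. *)
Lemma euler_tan_psum : euler tan_psum = odd_psum * (1 + tan_psum ^+ 2).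
Proof.
have ts : tan_psum * even_elemsym = odd_elemsym.
  by rewrite /tan_psum divrK ?even_elemsym_unit.
have := euler_odd_elemsym; rewrite -ts eulerM euler_even_elemsym -ts => H.
apply: (mulIr even_elemsym_unit).
have -> : euler tan_psum * even_elemsym =
    odd_psum * even_elemsym + even_psum * (tan_psum * even_elemsym) -
    tan_psum * (even_psum * even_elemsym -
                odd_psum * (tan_psum * even_elemsym)).
  by rewrite -H; ring.
ring.
Qed.

(** The sum of atan x_j over all variables, that is, the argument of the product of the 1 + i
    x_j. *)
Definition arg_psum : symseries F := fsum (fun k => chiV F k *: powersum F k).

Lemma arctan_tan_psum : arctan tan_psum = arg_psum.
Proof.
have t0 : agree 1 tan_psum 0 by apply/ord1P/const_tan_psum.
apply: (euler_inj F0).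
  have /ord1P -> := ord_arctan t0; apply/esym/ord1P.
  apply: ord_fsum => -[|k]; first by rewrite chiV0 scale0r.
  by apply/ordZ; apply: agree_le _ (@powersum_ord _).
have unit1 : 1 + tan_psum ^+ 2 \is a GRing.unit.
  by apply: const_term1_unit; rewrite const_termD const_term1 const_termX
    const_tan_psum expr0n addr0.
apply: (mulIr unit1); rewrite euler_arctan // euler_tan_psum; congr (_ * _).
rewrite /arg_psum /odd_psum euler_fsum; apply: eq_fsum => k.
apply: symseriesP => d n; rewrite eulerZ !scompZ eulerE /=.
case: eqP => [->|]; last by rewrite /= !scaler0.
case: k => [|k] /=; first by rewrite !scaler0.
by rewrite scalerA /chiV divfK // natrF_neq0.
Qed.

(** * The alternating Lie series and Möbius inversion *)

Definition odd_Lie : symseries F := fsum (fun n => chi F n *: Lie F n).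

Lemma Lie_ord n : agree n (Lie F n) 0.
Proof.
case: n => // n; apply: ordZ; rewrite big_seq; apply: agree_sum0 => d.
rewrite -dvdn_divisors // => dn; apply: ordZ.
by rewrite -{1}(divnK dn) mulnC; apply/ordX/powersum_ord.
Qed.

Lemma odd_LieE : fsum (fun n : nat => (-1) ^+ n *: Lie F (2 * n + 1)) = odd_Lie.
Proof.
pose u k := (-1) ^+ k./2 *: Lie F k.
rewrite (@eq_fsum _ _ (fun n => u (2 * n + 1)%N)); last first.
  by move=> k; rewrite /u addn1 mul2n /= uphalf_double.
rewrite fsum_odd => [|k]; last exact/ordZ/Lie_ord.
by apply: eq_fsum => k; rewrite /u /chi; case: ifP; rewrite ?scale0r.
Qed.

(** As [fsum] truncates by definition, both sides in degree d run over the same square i, j <= d. *)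
Lemma fsum_exchange (a : nat -> nat -> symseries F) :
  fsum (fun i => fsum (a i)) = fsum (fun j => fsum (a^~ j)).
Proof.
apply: symseriesP => d n; rewrite !fsumE.
under eq_bigr do rewrite fsumE.
by rewrite exchange_big; apply: eq_bigr => j _; rewrite fsumE.
Qed.

(** The inverse of [chiV] under Dirichlet convolution, by [sum_muV_chiV]. *)
Definition muV (d : nat) : F := (moebius d)%:~R * chiV F d.

Lemma muV0 : muV 0 = 0. Proof. by rewrite /muV chiV0 mulr0. Qed.

Lemma odd_Lie_arctan : odd_Lie = fsum (fun d => muV d *: arctan (powersum F d)).
Proof.
transitivity (fsum (fun i => fsum (fun j =>
    (muV i * chiV F j) *: powersum F i ^+ j))); last first.
  apply: eq_fsum => i; rewrite /arctan fsumZ.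
  by apply: eq_fsum => j; rewrite scalerA.
rewrite -(@fsum_divisors _
  (fun i j => (muV i * chiV F j) *: powersum F i ^+ j)).
- apply: eq_fsum => n; rewrite /Lie scalerA scaler_sumr big_seq [RHS]big_seq.
  apply: eq_bigr => d dn; rewrite scalerA; congr (_ *: _).
  have [n0|n0] := posnP n.
    by rewrite n0 div0n chiV0 mulr0 /chi /= !mul0r.
  rewrite -dvdn_divisors // in dn.
  by rewrite /muV -[RHS]mulrA -chiVM mulnC divnK // mulrC.
- by move=> i j; apply/ordZ/ordX/powersum_ord.
- by move=> j; rewrite muV0 mul0r scale0r.
- by move=> i; rewrite chiV0 mulr0 scale0r.
Qed.

Lemma sum_muV_chiV n :
  \sum_(d <- divisors n) muV d * chiV F (n %/ d) = (n == 1%N)%:R.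
Proof.
have [->|n0] := posnP n.
  by rewrite (_ : divisors 0 = [:: 1%N]) // big_seq1 chiV0 mulr0.
rewrite big_seq (eq_bigr (fun d => (moebius d)%:~R * chiV F n)); last first.
  move=> d; rewrite -dvdn_divisors // => dn.
  by rewrite /muV -mulrA -chiVM mulnC divnK.
rewrite -big_seq -mulr_suml -(rmorph_sum intr) sum_moebius //=.
by case: eqP => [->|_]; rewrite ?mul0r // chiV1 mulr1.
Qed.

(** Möbius inversion: collecting the pairs with d k = n leaves only n = 1. It is applied to the
    power sums and to their arctangents. *)
Lemma fsum_muV_chiV (u : nat -> symseries F) :
  (forall k, agree k (u k) 0) ->
  fsum (fun d => muV d *: fsum (fun k => chiV F k *: u (d * k)%N)) = u 1%N.
Proof.
move=> ordu.
transitivity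
    (fsum (fun i => fsum (fun j => (muV i * chiV F j) *: u (i * j)%N))).
  by apply: eq_fsum => i; rewrite fsumZ; apply: eq_fsum => j; rewrite scalerA.
rewrite -(@fsum_divisors _ (fun i j => (muV i * chiV F j) *: u (i * j)%N)).
- rewrite (@eq_fsum _ _ (fun n => (n == 1%N)%:R *: u n)).
    apply: symseriesP => d n; rewrite (@fsumE_le _ _ _ _ d.+2) //; last first.
      by move=> k; apply: ordZ.
    have one : (1 < d.+2)%N by [].
    rewrite (bigD1 (Ordinal one)) //= scale1r big1 ?addr0 // => i i1.
    by case: eqP => [e|_]; [case/eqP: i1; apply: val_inj | rewrite scale0r].
  move=> n; rewrite -sum_muV_chiV scaler_suml big_seq [RHS]big_seq.
  have [->|n0] := posnP n.
    by apply: eq_bigr => d _; rewrite div0n chiV0 mulr0 !scale0r.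
  by apply: eq_bigr => d; rewrite -dvdn_divisors // => dn; rewrite mulnC divnK.
- by move=> i j; apply: ordZ.
- by move=> j; rewrite muV0 mul0r scale0r.
- by move=> i; rewrite chiV0 mulr0 scale0r.
Qed.

(** * The two plethysms *)

Lemma psum_homP (G : nat -> symseries F) :
  (forall m, (0 < m)%N -> agree m (G m) 0) -> psum_hom_spec G (psum_hom G).
Proof.
(* The order condition provides a homomorphism, which excludes the default [idfun]. *)
move=> ordG; rewrite /psum_hom; case: pselect => [e|[]].
  by case: (cid e).
exact: psum_hom_exists.
Qed.

Lemma psum_plethP m : (0 < m)%N ->
  psum_hom_spec (fun k => powersum F (m * k))
    (psum_hom (fun k => powersum F (m * k))).
Proof.
move=> m0; apply: psum_homP => k _.
by apply: agree_le _ (@powersum_ord _); rewrite leq_pmull.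
Qed.

Lemma arg_psum_hom (phi : {lrmorphism symseries F -> symseries F})
    (G : nat -> symseries F) :
  (forall m, (0 < m)%N -> agree m (G m) 0) -> psum_hom_spec G phi ->
  phi arg_psum = fsum (fun k => chiV F k *: G k).
Proof.
move=> ordG [phic phiG].
have E k : phi (chiV F k *: powersum F k) = chiV F k *: G k.
  case: k => [|k]; first by rewrite chiV0 !scale0r raddf0.
  by rewrite linearZ /= phiG.
rewrite /arg_psum scontinuous_fsum //; first exact: eq_fsum.
  by move=> k; apply/ordZ/powersum_ord.
by case=> // k; rewrite E; apply/ordZ/ordG.
Qed.

Lemma odd_Lie_hom (phi : {lrmorphism symseries F -> symseries F})
    (G : nat -> symseries F) :
  (forall m, (0 < m)%N -> agree m (G m) 0) -> psum_hom_spec G phi ->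
  phi odd_Lie = fsum (fun d => muV d *: arctan (G d)).
Proof.
move=> ordG [phic phiG].
have E k : phi (muV k *: arctan (powersum F k)) = muV k *: arctan (G k).
  case: k => [|k]; first by rewrite muV0 !scale0r raddf0.
  rewrite linearZ /= scontinuous_arctan ?phiG //.
  exact: agree_le _ (@powersum_ord _).
rewrite odd_Lie_arctan scontinuous_fsum //; first exact: eq_fsum.
  by move=> k; apply/ordZ/ord_arctan/powersum_ord.
by case=> // k; rewrite E; apply/ordZ/ord_arctan/ordG.
Qed.

Lemma psum_pleth_odd_Lie m : (0 < m)%N ->
  psum_pleth m odd_Lie = fsum (fun d => muV d *: arctan (powersum F (m * d))).
Proof.
move=> m0; apply: odd_Lie_hom (psum_plethP m0) => k _.
by apply: agree_le _ (@powersum_ord _); rewrite leq_pmull.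
Qed.

Lemma arctan_psum_pleth_tan_psum m : (0 < m)%N ->
  arctan (psum_pleth m tan_psum) =
  fsum (fun k => chiV F k *: powersum F (m * k)).
Proof.
move=> m0; have [phic phiG] := psum_plethP m0.
rewrite /psum_pleth -scontinuous_arctan //; last exact/ord1P/const_tan_psum.
rewrite arctan_tan_psum; apply: arg_psum_hom (psum_plethP m0) => k _.
by apply: agree_le _ (@powersum_ord _); rewrite leq_pmull.
Qed.

Lemma psum_pleth_odd_Lie_ord m : (0 < m)%N -> agree m (psum_pleth m odd_Lie) 0.
Proof.
move=> m0; rewrite psum_pleth_odd_Lie //; apply: ord_fsum => -[|d].
  by rewrite muV0 scale0r.
apply/ordZ/ord_arctan; apply: agree_le _ (@powersum_ord _).
by rewrite leq_pmulr.
Qed.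

(** p_m[T] is known only through its arctangent, a series in the p_(mk); [arctan_inj] compares it
    with 0. *)
Lemma psum_pleth_tan_psum_ord m :
  (0 < m)%N -> agree m (psum_pleth m tan_psum) 0.
Proof.
move=> m0; have [phic _] := psum_plethP m0.
apply: arctan_inj => //.
  by apply: (scontinuous_const0 phic); apply/ord1P/const_tan_psum.
rewrite arctan_psum_pleth_tan_psum //.
apply: (agree_trans (g := 0)); last exact/agree_sym/ord_arctan.
apply: ord_fsum => -[|d]; first by rewrite chiV0 scale0r.
by apply/ordZ; apply: agree_le _ (@powersum_ord _); rewrite leq_pmulr.
Qed.

Lemma pleth_tan_psum_odd_Lie : pleth tan_psum odd_Lie = powersum F 1.
Proof.
have spec := psum_homP psum_pleth_odd_Lie_ord.
have [phic _] := spec.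
have t0 : agree 1 tan_psum 0 by apply/ord1P/const_tan_psum.
(* It suffices to compare arctangents, since A = atan T is an explicit series in the p_k. *)
apply: agree_eq => N; apply: arctan_inj.
- exact: scontinuous_const0 t0.
- exact: powersum_ord.
rewrite /pleth -scontinuous_arctan // arctan_tan_psum.
rewrite (arg_psum_hom psum_pleth_odd_Lie_ord spec).
rewrite (@eq_fsum _ _ (fun k => fsum (fun d =>
    (chiV F k * muV d) *: arctan (powersum F (k * d))))); last first.
  case=> [|k].
    rewrite chiV0 scale0r; apply: symseriesP => d n.
    by rewrite fsumE big1 // => i _; rewrite mul0r scale0r.
  rewrite psum_pleth_odd_Lie // fsumZ; apply: eq_fsum => d.
  by rewrite scalerA.
(* The exchange moves the coefficients [chiV] to the inner sum, as Möbius inversion with the series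
   atan(p_k) requires. *)
rewrite fsum_exchange.
rewrite (@eq_fsum _ _ (fun d => muV d *: fsum (fun k =>
    chiV F k *: arctan (powersum F (d * k))))); last first.
  move=> d; rewrite fsumZ; apply: eq_fsum => k.
  by rewrite scalerA [muV d * _]mulrC [(d * k)%N]mulnC.
by rewrite (@fsum_muV_chiV (fun k => arctan (powersum F k))) // => k;
  apply/ord_arctan/powersum_ord.
Qed.

Lemma pleth_odd_Lie_tan_psum : pleth odd_Lie tan_psum = powersum F 1.
Proof.
have spec := psum_homP psum_pleth_tan_psum_ord.
rewrite /pleth (odd_Lie_hom psum_pleth_tan_psum_ord spec).
(* Möbius inversion is read backwards: p_1 becomes a double sum whose inner sums are the
   atan(p_d[T]). *)
rewrite -[RHS](@fsum_muV_chiV (powersum F)); last exact: powersum_ord.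
apply: eq_fsum => -[|d]; first by rewrite muV0 !scale0r.
by rewrite arctan_psum_pleth_tan_psum.
Qed.

End Tangent.

Unset Implicit Arguments.

Theorem theorem1p2 (F : fieldType) (F_char0 : [pchar F] =i pred0) :
  plethystic_inverses
    (fsum (fun n : nat => (-1) ^+ n *: elemsym F (2 * n + 1))
       / fsum (fun n : nat => (-1) ^+ n *: elemsym F (2 * n)))
    (fsum (fun n : nat => (-1) ^+ n *: Lie F (2 * n + 1))).
Proof.
rewrite odd_elemsymE even_elemsymE odd_LieE; split.
- exact: const_tan_psum.
- apply/ord1P/ord_fsum => -[|k]; first by rewrite scale0r.
  exact/ordZ/agree_le/Lie_ord.
- exact: pleth_tan_psum_odd_Lie.
- exact: pleth_odd_Lie_tan_psum.
Qed.
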